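(* Let $\Delta$ be an irreducible reduced crystallographic root system with simple roots $\Pi$ and Weyl group $W$, and consider a $1$-standard $\mathbb Z$-grading with $\Pi=\Pi(0)\sqcup\{\tilde\alpha\}$, i.e. $\Delta(i)=\{\gamma\in\Delta\mid [\gamma:\tilde\alpha]=i\}$. For $w\in W^0$ and $\alpha\in\Pi$ let $k_\alpha(w)=[w^{-1}(\alpha):\tilde\alpha]$ and define $\eta:W^0\to\mathbb Z^{\Pi}$, $\eta(w)=(k_\alpha(w))_{\alpha\in\Pi}$. Then: (i) $\eta$ is injective; (ii) $\eta(W^0_{\min})=\{\eta(w)\mid w\in W^0,\ k_\alpha(w)\ge -1\ \text{for all }\alpha\in\Pi\}$; (iii) $\eta(W^0_{\max})=\{\eta(w)\mid w\in W^0,\ k_\alpha(w)\le 1\ \text{for all }\alpha\in\Pi\}$.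
   Context: $[\gamma:\alpha]$ denotes the coefficient of the simple root $\alpha$ in $\gamma$. The positive system $\Delta^+=\Delta(0)^+\sqcup\bigsqcup_{i\ge1}\Delta(i)$. Order: $\mu\preccurlyeq\gamma$ iff $\gamma-\mu$ is a nonnegative integer combination of simple roots; lower ideals of $\Delta(1)$ are its downward closed subsets; $I^c=\Delta(1)\setminus I$; $\Delta(\ge1)=\bigsqcup_{j\ge1}\Delta(j)$. $N(w)=\{\gamma\in\Delta^+\mid w(\gamma)\in-\Delta^+\}$. $W^0=\{w\in W\mid w(\alpha)\in\Delta^+\ \forall\alpha\in\Delta(0)^+\}$. For $J\subset\Delta^+$: $J^1=J$, $J^k=(J+J^{k-1})\cap\Delta$, $\langle J\rangle=\bigcup_{k\ge1}J^k$. $w_{I,\min}$ is the unique $w\in W$ with $N(w)=\langle I\rangle$, $w_{I,\max}$ the unique $w\in W$ with $N(w)=\Delta(\ge1)\setminus\langle I^c\rangle$; $W^0_{\min}=\{w_{I,\min}\}$ and $W^0_{\max}=\{w_{I,\max}\}$, $I$ ranging over lower ideals of $\Delta(1)$. *)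

(* Defs.v *)
From HB Require Import structures.
From mathcomp Require Export all_boot all_order all_algebra finmap.
From mathcomp Require Export mathcomp_extra boolp classical_sets functions reals.
Set Implicit Arguments.
Unset Strict Implicit.
Unset Printing Implicit Defensive.
Import Order.TTheory GRing.Theory Num.Theory.
Local Open Scope classical_set_scope.
Local Open Scope ring_scope.

Definition dot {R : realType} {n : nat} (u v : 'rV[R]_n) : R :=
  (u *m v^T) 0 0.

Definition refl_fun {R : realType} {n : nat} (a v : 'rV[R]_n) : 'rV[R]_n :=
  v - (2%:R * dot v a / dot a a) *: a.

Lemma refl_fun_is_linear (R : realType) (n : nat) (a : 'rV[R]_n) :
  linear (refl_fun a).
Proof.
move=> k u v; rewrite /refl_fun /dot mulmxDl -scalemxAl !mxE.
rewrite scalerBr scalerA addrACA -opprD -scalerDl; congr (_ - _ *: _).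
by rewrite mulrDr mulrDl !mulrA [2%:R * k]mulrC.
Qed.

HB.instance Definition _ (R : realType) (n : nat) (a : 'rV[R]_n) :=
  GRing.isLinear.Build R 'rV[R]_n 'rV[R]_n _ (refl_fun a)
    (@refl_fun_is_linear R n a).

Definition refl {R : realType} {n : nat} (a : 'rV[R]_n) : 'End('rV[R]_n) :=
  linfun (refl_fun a).

Record root_system {R : realType} {n : nat} (D : {fset 'rV[R]_n}) : Prop :=
  RootSystem {
    root_span : <<enum_fset D>>%VS = fullv;
    root_neq0 : 0 \notin D;
    root_refl : forall a b, a \in D -> b \in D -> refl a b \in D;
    root_integral : forall a b, a \in D -> b \in D ->
      2%:R * dot b a / dot a a \is a Num.int }.

Definition reduced {R : realType} {n : nat} (D : {fset 'rV[R]_n}) : Prop :=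
  forall (a : 'rV[R]_n) (c : R),
    a \in D -> c *: a \in D -> c = 1 \/ c = -1.

Definition irreducible {R : realType} {n : nat} (D : {fset 'rV[R]_n}) : Prop :=
  D != fset0 /\
  forall A B : {fset 'rV[R]_n}, D = (A `|` B)%fset ->
    (forall a b, a \in A -> b \in B -> dot a b = 0) ->
    A = fset0 \/ B = fset0.

(* The Weyl group; reflections are involutions, so the monoid they generate
   is the group they generate. *)
Inductive weyl {R : realType} {n : nat} (D : {fset 'rV[R]_n}) :
    'End('rV[R]_n) -> Prop :=
| weyl_id : weyl D \1%VF
| weyl_comp a w : a \in D -> weyl D w -> weyl D (refl a \o w)%VF.

Definition natcomb {R : realType} {n : nat} (P : n.-tuple 'rV[R]_n)
    (v : 'rV[R]_n) : Prop :=
  exists c : 'I_n -> nat, v = \sum_(i < n) (c i)%:R *: tnth P i.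

(* A root system spans its ambient space, so its rank is n and a system of
   simple roots is an n-tuple. *)
Record simple_system {R : realType} {n : nat} (D : {fset 'rV[R]_n})
    (P : n.-tuple 'rV[R]_n) : Prop := SimpleSystem {
  simple_sub : {subset P <= D};
  simple_basis : basis_of fullv P;
  simple_sign : forall g, g \in D -> natcomb P g \/ natcomb P (- g) }.

(* [v : P_i]; the coordinates of a root are integers, so that the floor is
   exact wherever this is used. *)
Definition coef {R : realType} {n : nat} (P : n.-tuple 'rV[R]_n)
    (v : 'rV[R]_n) (i : 'I_n) : int :=
  Num.floor (coord P i v).

Definition pos_roots {R : realType} {n : nat} (D : {fset 'rV[R]_n})
    (P : n.-tuple 'rV[R]_n) : set 'rV[R]_n :=
  [set g | g \in D /\ natcomb P g].

Definition root_le {R : realType} {n : nat} (P : n.-tuple 'rV[R]_n)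
    (m g : 'rV[R]_n) : Prop :=
  natcomb P (g - m).

(* From here on, the index t singles out the simple root of degree 1. *)
Definition grade {R : realType} {n : nat} (D : {fset 'rV[R]_n})
    (P : n.-tuple 'rV[R]_n) (t : 'I_n) (k : int) : set 'rV[R]_n :=
  [set g | g \in D /\ coef P g t = k].

Definition grade_ge1 {R : realType} {n : nat} (D : {fset 'rV[R]_n})
    (P : n.-tuple 'rV[R]_n) (t : 'I_n) : set 'rV[R]_n :=
  [set g | exists2 k : int, 1 <= k & grade D P t k g].

Definition lower_ideal {R : realType} {n : nat} (D : {fset 'rV[R]_n})
    (P : n.-tuple 'rV[R]_n) (t : 'I_n) (I : set 'rV[R]_n) : Prop :=
  I `<=` grade D P t 1 /\
  forall m g, grade D P t 1 m -> I g -> root_le P m g -> I m.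

Definition inversions {R : realType} {n : nat} (D : {fset 'rV[R]_n})
    (P : n.-tuple 'rV[R]_n) (w : 'End('rV[R]_n)) : set 'rV[R]_n :=
  [set g | pos_roots D P g /\ pos_roots D P (- w g)].

Definition W0 {R : realType} {n : nat} (D : {fset 'rV[R]_n})
    (P : n.-tuple 'rV[R]_n) (t : 'I_n) : set 'End('rV[R]_n) :=
  [set w | weyl D w /\
     forall a, grade D P t 0 a -> pos_roots D P a -> pos_roots D P (w a)].

(* [root_pow D J k] is J^(k+1). *)
Fixpoint root_pow {R : realType} {n : nat} (D : {fset 'rV[R]_n})
    (J : set 'rV[R]_n) (k : nat) : set 'rV[R]_n :=
  if k is k'.+1 then
    [set g | g \in D /\
       exists x y, [/\ J x, root_pow D J k' y & g = x + y]]
  else J.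

Definition root_gen {R : realType} {n : nat} (D : {fset 'rV[R]_n})
    (J : set 'rV[R]_n) : set 'rV[R]_n :=
  \bigcup_k root_pow D J k.

(* An element of the Weyl group is determined by its inversion set, so
   [is_wmin] and [is_wmax] characterize at most one w for each I. *)
Definition is_wmin {R : realType} {n : nat} (D : {fset 'rV[R]_n})
    (P : n.-tuple 'rV[R]_n) (I : set 'rV[R]_n) (w : 'End('rV[R]_n)) : Prop :=
  weyl D w /\ inversions D P w = root_gen D I.

Definition is_wmax {R : realType} {n : nat} (D : {fset 'rV[R]_n})
    (P : n.-tuple 'rV[R]_n) (t : 'I_n) (I : set 'rV[R]_n)
    (w : 'End('rV[R]_n)) : Prop :=
  weyl D w /\
  inversions D P w = grade_ge1 D P t `\` root_gen D (grade D P t 1 `\` I).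

Definition W0min {R : realType} {n : nat} (D : {fset 'rV[R]_n})
    (P : n.-tuple 'rV[R]_n) (t : 'I_n) : set 'End('rV[R]_n) :=
  [set w | exists2 I, lower_ideal D P t I & is_wmin D P I w].

Definition W0max {R : realType} {n : nat} (D : {fset 'rV[R]_n})
    (P : n.-tuple 'rV[R]_n) (t : 'I_n) : set 'End('rV[R]_n) :=
  [set w | exists2 I, lower_ideal D P t I & is_wmax D P t I w].

Definition kcoef {R : realType} {n : nat} (P : n.-tuple 'rV[R]_n) (t : 'I_n)
    (w : 'End('rV[R]_n)) (i : 'I_n) : int :=
  coef P ((w^-1)%VF (tnth P i)) t.

(* Simple roots are indexed by 'I_n. *)
Definition eta {R : realType} {n : nat} (P : n.-tuple 'rV[R]_n) (t : 'I_n)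
    (w : 'End('rV[R]_n)) : {ffun 'I_n -> int} :=
  [ffun i => kcoef P t w i].

(* Main.v *)
(* For a Weyl group element w let f be w or -w, S the set of roots sent by f to
   positive roots, M the set of roots of S of degree at least 1, and J the part
   of M of degree 1.  Both (ii) and (iii) reduce to one equivalence: M = <J> if
   and only if the f-preimages of the simple roots all have degree at most 1.
   One direction holds because a simple root is not a sum of two positive roots.
   The other is an induction on the height of f g for g in M: if f g is not
   simple, it is a sum of two positive roots, hence g = u + v with u, v in S and
   v, say, in M; then v is in <J> by induction, and <J> is stable under adding
   elements of S as long as the result is a root of degree at least 1 (for
   u in <J>, and for u of degree at most 0).
   For (i), eta(w) determines the degree of w^-1(_), and an element of W^0 is
   determined by it because the Weyl group acts freely on positive systems. *)
From mathcomp Require Import zify ring lra.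
Require Import Defs.
Import Order.TTheory GRing.Theory Num.Theory.
Local Open Scope classical_set_scope.
Local Open Scope ring_scope.
Set Implicit Arguments.
Unset Strict Implicit.
Unset Printing Implicit Defensive.

(** * Inner product and reflections *)

Section Dot.
Variables (R : realType) (n : nat).
Implicit Types a b u v w : 'rV[R]_n.

Lemma dotC u v : dot u v = dot v u.
Proof. by rewrite /dot -[u *m _]trmxK trmx_mul trmxK mxE. Qed.

Lemma dotDl u v w : dot (u + v) w = dot u w + dot v w.
Proof. by rewrite /dot mulmxDl mxE. Qed.

Lemma dotZl c u w : dot (c *: u) w = c * dot u w.
Proof. by rewrite /dot -scalemxAl mxE. Qed.

Lemma dotNl u w : dot (- u) w = - dot u w.
Proof. by rewrite -scaleN1r dotZl mulN1r. Qed.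

Lemma dotDr u v w : dot u (v + w) = dot u v + dot u w.
Proof. by rewrite dotC dotDl !(dotC u). Qed.

Lemma dotZr c u w : dot u (c *: w) = c * dot u w.
Proof. by rewrite dotC dotZl dotC. Qed.

Lemma dotNr u w : dot u (- w) = - dot u w.
Proof. by rewrite dotC dotNl dotC. Qed.

Lemma dot0l w : dot 0 w = 0.
Proof. by rewrite -(scale0r 0) dotZl mul0r. Qed.

Lemma dot_suml (I : finType) (F : I -> 'rV[R]_n) w :
  dot (\sum_i F i) w = \sum_i dot (F i) w.
Proof.
by apply: (big_morph (fun u => dot u w)) => [u v|]; rewrite ?dotDl ?dot0l.
Qed.

Lemma dot_ge0 u : 0 <= dot u u.
Proof.
rewrite /dot mxE; apply: sumr_ge0 => i _.
by rewrite mxE -expr2 sqr_ge0.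
Qed.

Lemma dot_eq0 u : dot u u = 0 -> u = 0.
Proof.
rewrite /dot mxE => /eqP; rewrite psumr_eq0; last first.
  by move=> i _; rewrite mxE -expr2 sqr_ge0.
move=> /allP h; apply/rowP => i; rewrite [RHS]mxE.
have /= := h i (mem_index_enum _).
by rewrite mxE mulf_eq0 orbb => /eqP.
Qed.

Lemma dot_gt0 u : u != 0 -> 0 < dot u u.
Proof.
by move=> u0; rewrite lt_def dot_ge0 andbT; apply: contra u0 => /eqP/dot_eq0->.
Qed.

Lemma refl_funK a : involutive (refl_fun a).
Proof.
move=> v; have [->|a0] := eqVneq a 0; first by rewrite /refl_fun !scaler0 !subr0.
have d0 : dot a a != 0 by rewrite gt_eqF ?dot_gt0.
rewrite /refl_fun dotDl dotNl dotZl -addrA -opprD -scalerDl.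
rewrite [X in X *: a](_ : _ = 0) ?scale0r ?subr0 //.
by field.
Qed.

Lemma refl_fun_self a : a != 0 -> refl_fun a a = - a.
Proof.
move=> /dot_gt0/gt_eqF/negbT d0.
by rewrite /refl_fun mulfK // [2%:R]/(1 + 1) scalerDl scale1r opprD addrA subrr sub0r.
Qed.

Lemma dot_refl_fun a u v : dot (refl_fun a u) (refl_fun a v) = dot u v.
Proof.
have [->|a0] := eqVneq a 0; first by rewrite /refl_fun !scaler0 !subr0.
have d0 : dot a a != 0 by rewrite gt_eqF ?dot_gt0.
rewrite /refl_fun !(dotDl, dotDr, dotNl, dotNr, dotZl, dotZr) (dotC a v).
by field.
Qed.

(** Holds because [refl_fun a] is an isometry and an involution; it later rewrites every reflection
    as a word in simple ones. *)
Lemma refl_fun_conj a u v :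
  refl_fun (refl_fun a u) v = refl_fun a (refl_fun u (refl_fun a v)).
Proof.
have hd : dot (refl_fun a v) u = dot v (refl_fun a u).
  by rewrite -(dot_refl_fun a) refl_funK.
have -> : refl_fun u (refl_fun a v) =
          refl_fun a v - (2%:R * dot (refl_fun a v) u / dot u u) *: u by [].
by rewrite linearB linearZ /= refl_funK hd -(dot_refl_fun a u u).
Qed.

End Dot.

(** * Sums and differences of roots *)

Section Roots.
Variables (R : realType) (n : nat) (D : {fset 'rV[R]_n}) (P : n.-tuple 'rV[R]_n).
Hypotheses (hD : root_system D) (hred : reduced D) (hP : simple_system D P).
Implicit Types a b c g u v x y : 'rV[R]_n.
Local Notation pos := (pos_roots D P).
Local Notation alpha := (tnth P).

Lemma root_nz a : a \in D -> a != 0.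
Proof. by move=> aD; apply: contraNneq (root_neq0 hD) => <-. Qed.

Lemma refl_fun_root a b : a \in D -> b \in D -> refl_fun a b \in D.
Proof. by move=> aD bD; move: (root_refl hD aD bD); rewrite lfunE. Qed.

Lemma rootN a : a \in D -> - a \in D.
Proof. by move=> aD; rewrite -refl_fun_self ?root_nz ?refl_fun_root. Qed.

(** By integrality, if neither reflection subtracts exactly one copy of the other root, then (a,b)
    is at least both (a,a) and (b,b), whence |a - b|^2 <= 0. *)
Lemma root_sub a b : a \in D -> b \in D -> 0 < dot a b -> a != b -> a - b \in D.
Proof.
move=> aD bD ab neq.
have aa := dot_gt0 (root_nz aD); have bb := dot_gt0 (root_nz bD).
have intC x y : x \in D -> y \in D -> 0 < dot x y ->
    refl_fun y x = x - y \/ dot y y <= dot x y.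
  move=> xD yD xy; have yy := dot_gt0 (root_nz yD).
  have /intrP[m hm] := root_integral hD yD xD.
  have hxy : 2%:R * dot x y = m%:~R * dot y y by rewrite -hm divfK // gt_eqF.
  have m0 : 0 < m.
    by rewrite -(ltr0z R) -hm divr_gt0 // mulr_gt0.
  have [m1|m1] := eqVneq m 1; [left|right].
    by rewrite /refl_fun hm m1 scale1r.
  have m2 : (2 : R) <= m%:~R.
    by rewrite -[2]/(2%:~R) ler_int; lia.
  nra.
have [h|h1] := intC a b aD bD ab; first by rewrite -h refl_fun_root.
have [h|h2] := intC b a bD aD (etrans (congr1 _ (dotC b a)) ab).
  by rewrite -opprB -h rootN // refl_fun_root.
have : dot (a - b) (a - b) = 0.
  apply/eqP; rewrite eq_le dot_ge0 andbT.
  rewrite !(dotDl, dotDr, dotNl, dotNr) (dotC b a) in h2 *; lra.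
by move/dot_eq0/eqP; rewrite subr_eq0 (negPf neq).
Qed.

(* If a + b and a + c were neither roots nor zero, then a would have nonnegative
   products with b and c, and a + b + c nonpositive ones with both; expanding
   |a + b + c|^2 and |b + c|^2 gives a contradiction. *)
Lemma root_add3 a b c : a \in D -> b \in D -> c \in D -> b + c != 0 ->
  a + b + c \in D -> a + b != 0 -> a + c != 0 -> a + b \in D \/ a + c \in D.
Proof.
move=> aD bD cD bc0 sD ab0 ac0; apply: contrapT => /not_orP[nab nac].
have bc := dot_gt0 bc0.
have addP x y : x \in D -> y \in D -> x + y != 0 -> ~ (x + y \in D) ->
    0 <= dot x y.
  move=> xD yD xy0 nxy; rewrite leNgt; apply/negP => lt0.
  apply: nxy; rewrite -[y]opprK; apply: root_sub; rewrite ?rootN ?dotNr ?oppr_gt0//.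
  by rewrite -addr_eq0.
have subP x y : x \in D -> y \in D -> x - y != 0 -> ~ (x - y \in D) ->
    dot x y <= 0.
  move=> xD yD xy0 nxy; rewrite leNgt; apply/negP => lt0.
  by apply: nxy; apply: root_sub => //; rewrite -subr_eq0.
have h1 := addP _ _ aD bD ab0 nab; have h2 := addP _ _ aD cD ac0 nac.
have e1 : a + b + c - c = a + b by rewrite addrK.
have e2 : a + b + c - b = a + c by rewrite addrAC addrK.
have := subP _ _ sD cD; rewrite e1 => /(_ ab0 nab) h3.
have := subP _ _ sD bD; rewrite e2 => /(_ ac0 nac) h4.
move: bc h1 h2 h3 h4; rewrite !(dotDl, dotDr) (dotC c b).
lra.
Qed.

(** * Coordinates and signs of roots *)

Lemma simple_root i : alpha i \in D.
Proof. by apply: (simple_sub hP); apply: mem_tnth. Qed.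

Lemma coord_sum v : v = \sum_i coord P i v *: alpha i.
Proof.
rewrite {1}(coord_basis (simple_basis hP) (memvf v)).
by apply: eq_bigr => i _; rewrite (tnth_nth 0).
Qed.

Lemma coord_simple i j : coord P i (alpha j) = (j == i)%:R.
Proof. by rewrite (tnth_nth 0) (coord_free _ _ (basis_free (simple_basis hP))). Qed.

Lemma coord_lincomb (c : 'I_n -> R) i :
  coord P i (\sum_j c j *: alpha j) = c i.
Proof.
rewrite linear_sum (bigD1 i) //= linearZ /= coord_simple eqxx mulr1.
rewrite big1 ?addr0 // => j ji.
by rewrite linearZ /= coord_simple (negPf ji) mulr0.
Qed.

Lemma natcombP v : natcomb P v <-> forall i, exists m, coord P i v = m%:R.
Proof.
split=> [[c ->] i|h]; first by exists (c i); rewrite coord_lincomb.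
have [c hc] := choice h; exists c; rewrite {1}(coord_sum v).
by apply: eq_bigr => i _; rewrite hc.
Qed.

Lemma natcombD u v : natcomb P u -> natcomb P v -> natcomb P (u + v).
Proof.
move=> [c ->] [d ->]; exists (fun i => c i + d i)%N.
by rewrite -big_split; apply: eq_bigr => i _; rewrite natrD scalerDl.
Qed.

(** Zero coefficients are exempt because in [inv1_lower_ideal] nothing is known about the sign of
    w(alpha_t). *)
Lemma natcomb_sum (c : 'I_n -> nat) (F : 'I_n -> 'rV[R]_n) :
  (forall i, c i != 0%N -> natcomb P (F i)) ->
  natcomb P (\sum_i (c i)%:R *: F i).
Proof.
move=> h; apply: (big_ind (natcomb P)); last 1 first.
- move=> i _; have [->|ci] := eqVneq (c i) 0%N.
    by rewrite scale0r; exists (fun=> 0%N); rewrite big1 // => j; rewrite scale0r.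
  have [d ->] := h i ci; exists (fun j => c i * d j)%N.
  by rewrite scaler_sumr; apply: eq_bigr => j _; rewrite scalerA natrM.
- by exists (fun=> 0%N); rewrite big1 // => j; rewrite scale0r.
- exact: natcombD.
Qed.

Lemma natcomb_coord_ge0 v i : natcomb P v -> 0 <= coord P i v.
Proof. by move/natcombP/(_ i) => [m ->]. Qed.

Lemma posN g : pos g -> ~ pos (- g).
Proof.
move=> [gD g1] [_ g2]; move/negP: (root_nz gD); apply.
rewrite (coord_sum g) big1 // => i _.
have := natcomb_coord_ge0 i g1; have := natcomb_coord_ge0 i g2.
rewrite linearN /= => h1 h2.
by rewrite [coord _ _ _](_ : _ = 0) ?scale0r //; lra.
Qed.

Lemma pos_or_neg g : g \in D -> pos g \/ pos (- g).
Proof.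
by move=> gD; case: (simple_sign hP gD) => h; [left|right]; split=> //; apply: rootN.
Qed.

Lemma posD x y : pos x -> pos y -> x + y \in D -> pos (x + y).
Proof. by move=> [_ x1] [_ y1]; split=> //; apply: natcombD. Qed.

Lemma posD_neq0 x y : pos x -> pos y -> x + y != 0.
Proof.
by move=> px py; apply/eqP => /eqP; rewrite addr_eq0 => /eqP e;
  case: (posN py); rewrite -e.
Qed.

Lemma natcomb_simple i : natcomb P (alpha i).
Proof. by apply/natcombP => j; rewrite coord_simple; exists (i == j). Qed.

Lemma pos_simple i : pos (alpha i).
Proof. by split; [apply: simple_root|apply: natcomb_simple]. Qed.

Lemma coord_root g i : g \in D -> coord P i g \is a Num.int.
Proof.
move=> /(simple_sign hP)[] /natcombP/(_ i)[m hm]; first by rewrite hm.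
rewrite linearN /= in hm.
rewrite -[coord _ _ _]opprK hm rpredN; exact: natr_int.
Qed.

Lemma coef_root g i : g \in D -> (coef P g i)%:~R = coord P i g.
Proof. by move=> gD; rewrite /coef floorK // coord_root. Qed.

Lemma coefD x y i : x \in D -> y \in D -> coef P (x + y) i = coef P x i + coef P y i.
Proof. by move=> xD yD; rewrite /coef linearD /= floorDzr // coord_root. Qed.

Lemma coefN x i : x \in D -> coef P (- x) i = - coef P x i.
Proof. by move=> xD; rewrite /coef linearN /= floorN // coord_root. Qed.

Lemma coef_pos g i : pos g -> 0 <= coef P g i.
Proof.
by move=> [gD g1]; rewrite -(ler0z R) coef_root // natcomb_coord_ge0.
Qed.

Lemma coef_gt0_pos g i : g \in D -> 0 < coef P g i -> pos g.
Proof.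
move=> gD gi; have [//|/(coef_pos i)] := pos_or_neg gD.
by rewrite coefN // oppr_ge0 leNgt gi.
Qed.

Lemma coef_simple i j : coef P (alpha j) i = (j == i)%:R.
Proof. by rewrite /coef coord_simple; case: eqP => _; rewrite ?floor1 ?floor0. Qed.

(** * Height and decomposition of positive roots *)

Definition height v : R := \sum_i coord P i v.

Lemma heightD u v : height (u + v) = height u + height v.
Proof. by rewrite -big_split; apply: eq_bigr => i _; rewrite linearD. Qed.

Lemma heightB u v : height (u - v) = height u - height v.
Proof. by rewrite -sumrB; apply: eq_bigr => i _; rewrite linearB. Qed.

Lemma heightZ (k : R) v : height (k *: v) = k * height v.
Proof. by rewrite mulr_sumr; apply: eq_bigr => i _; rewrite linearZ. Qed.

Lemma height_simple i : height (alpha i) = 1.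
Proof.
rewrite /height (bigD1 i) //= coord_simple eqxx big1 ?addr0 // => j ji.
by rewrite coord_simple eq_sym (negPf ji).
Qed.

Lemma height_pos g : pos g -> exists m : nat, height g = m.+1%:R.
Proof.
move=> [gD /natcombP/choice[c hc]].
have h : height g = (\sum_i c i)%:R.
  by rewrite natr_sum; apply: eq_bigr => i _; rewrite hc.
case e : (\sum_i c i)%N h => [|m] h; last by exists m.
have/negP[] := root_nz gD; rewrite (coord_sum g) big1 // => i _.
move/eqP: e; rewrite sum_nat_eq0 => /forallP/(_ i)/implyP/(_ isT)/eqP ci.
by rewrite hc ci scale0r.
Qed.

Lemma height_gt0 g : pos g -> 0 < height g.
Proof. by move=> /height_pos[m ->]. Qed.

Lemma height_ind (Q : 'rV[R]_n -> Prop) :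
  (forall g, pos g -> (forall h, pos h -> height h < height g -> Q h) -> Q g) ->
  forall g, pos g -> Q g.
Proof.
move=> step g pg.
have [N hN] : exists N : nat, height g < N%:R.
  by have [m ->] := height_pos pg; exists m.+2; rewrite ltr_nat.
elim: N g pg hN => [|N IH] g pg hN.
  by have := lt_trans (height_gt0 pg) hN; rewrite ltxx.
apply: step => // h ph hg; apply: IH => //.
have [m1 e1] := height_pos pg; have [m2 e2] := height_pos ph.
by move: hN hg; rewrite e1 e2 !ltr_nat; lia.
Qed.

Lemma simple_indec i x y : pos x -> pos y -> alpha i <> x + y.
Proof.
move=> /height_pos[a ha] /height_pos[b hb] /(congr1 height).
rewrite height_simple heightD ha hb -natrD => /eqP.
by rewrite -[1]/(1%:R) eqr_nat; lia.
Qed.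

Lemma simple_dot_gt0 g : pos g -> exists i, 0 < dot g (alpha i).
Proof.
move=> [gD g1]; apply: contrapT => /forallNP h.
have := dot_gt0 (root_nz gD); rewrite {1}(coord_sum g) dot_suml ltNge => /negP; apply.
apply: sumr_le0 => i _; rewrite dotZl mulr_ge0_le0 ?natcomb_coord_ge0 //.
by rewrite dotC leNgt; apply/negP/h.
Qed.

(** Subtract a simple root having positive product with g; the difference cannot be negative, as
    alpha_i would then be the sum of g and alpha_i - g. *)
Lemma pos_decomp g : pos g ->
  (exists i, g = alpha i) \/
  (exists x y, [/\ pos x, pos y & g = x + y]).
Proof.
move=> pg; have [i gi] := simple_dot_gt0 pg.
have [->|neq] := eqVneq g (alpha i); [by left; exists i|right].
have sD := root_sub pg.1 (simple_root i) gi neq.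
exists (alpha i), (g - alpha i); split; [exact: pos_simple| |by rewrite subrKC].
have [//|ng] := pos_or_neg sD.
by case: (@simple_indec i _ _ pg ng); rewrite opprB subrKC.
Qed.

(** Only the i-th coordinate changes, so a negative image forces g to be proportional to alpha_i,
    and reducedness leaves g = alpha_i. *)
Lemma simple_refl_pos i g : pos g -> g != alpha i -> pos (refl_fun (alpha i) g).
Proof.
move=> pg neq; have sD := refl_fun_root (simple_root i) pg.1.
have [//|[_ ng]] := pos_or_neg sD.
have cg j : j != i -> coord P j g = 0.
  move=> ji; have := natcomb_coord_ge0 j pg.2; have := natcomb_coord_ge0 j ng.
  rewrite linearN /refl_fun linearB linearZ /= coord_simple eq_sym (negPf ji).
  rewrite mulr0 subr0 => h1 h2; lra.
have eg : g = coord P i g *: alpha i.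
  rewrite {1}(coord_sum g) (bigD1 i) //= big1 ?addr0 // => j ji.
  by rewrite cg // scale0r.
have := hred (simple_root i); move/(_ (coord P i g)); rewrite -eg => /(_ pg.1).
case=> ci; first by rewrite eg ci scale1r eqxx in neq.
by case: (posN (pos_simple i)); rewrite -scaleN1r -ci -eg.
Qed.

(** * Words in simple reflections and the exchange property *)

Definition word_act (s : seq 'I_n) v := foldr (fun i => refl_fun (alpha i)) v s.

Lemma word_act_cat s1 s2 v : word_act (s1 ++ s2) v = word_act s1 (word_act s2 v).
Proof. exact: foldr_cat. Qed.

Lemma word_actN s v : word_act s (- v) = - word_act s v.
Proof. by elim: s => //= i s ->; rewrite linearN. Qed.

Lemma word_act_root s v : v \in D -> word_act s v \in D.
Proof. by move=> vD; elim: s => //= i s; apply/refl_fun_root/simple_root. Qed.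

Lemma word_act_revK s : cancel (word_act (rev s)) (word_act s).
Proof.
elim: s => //= i s IH v; rewrite rev_cons -cats1 word_act_cat /= IH.
exact: refl_funK.
Qed.

Lemma word_actK s : cancel (word_act s) (word_act (rev s)).
Proof. by move=> v; have := word_act_revK (rev s) v; rewrite revK. Qed.

Lemma refl_fun_word s v x :
  refl_fun (word_act s v) x = word_act s (refl_fun v (word_act (rev s) x)).
Proof.
elim: s x => //= i s IH x.
by rewrite refl_fun_conj IH rev_cons -cats1 word_act_cat.
Qed.

(** Reflecting in a simple root with positive product lowers the height and, unless g is that root,
    keeps g positive. *)
Lemma pos_word g : pos g -> exists s i, g = word_act s (alpha i).
Proof.
move: g; apply: height_ind => g pg IH.
have [i gi] := simple_dot_gt0 pg.
have [->|neq] := eqVneq g (alpha i); first by exists [::], i.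
have ps := simple_refl_pos pg neq.
have [|s [j e]] := IH _ ps; last first.
  by exists (i :: s), j; rewrite /= -e refl_funK.
rewrite /refl_fun heightB heightZ height_simple mulr1 ltrBlDr ltrDl.
by rewrite divr_gt0 ?mulr_gt0 // dot_gt0 // root_nz // simple_root.
Qed.

Lemma root_word g : g \in D -> exists s i, g = word_act s (alpha i).
Proof.
move=> gD; have [/pos_word//|/pos_word[s [i e]]] := pos_or_neg gD.
exists (s ++ [:: i]), i.
by rewrite word_act_cat /= refl_fun_self ?root_nz ?simple_root // word_actN -e opprK.
Qed.

Lemma weyl_word w : weyl D w -> exists s, w =1 word_act s.
Proof.
elim=> [|a w' aD _ [s hs]]; first by exists [::] => v; rewrite id_lfunE.
have [s' [i e]] := root_word aD.
exists (s' ++ i :: rev s' ++ s) => v.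
by rewrite comp_lfunE lfunE /= hs e refl_fun_word word_act_cat /= word_act_cat.
Qed.

(** Somewhere along the word the sign changes from positive to negative; the letter responsible must
    act on its own simple root. *)
Lemma word_exchange s g : pos g -> pos (- word_act s g) ->
  exists s1 j s2, s = s1 ++ j :: s2 /\ word_act s2 g = alpha j.
Proof.
move=> pg; elim: s => [/(posN pg)//|j s IH /= ns].
have [ps|/IH[s1 [i [s2 [-> e]]]]] := pos_or_neg (word_act_root s pg.1); last first.
  by exists (j :: s1), i, s2.
exists [::], j, s; split=> //; apply/eqP/negPn/negP => neq.
by case: (posN (simple_refl_pos ps neq)).
Qed.

(* If s = s' k is a nonempty word preserving the positive roots, then s' sends
   alpha_k to a negative root, so the exchange property removes the last letter
   and one letter of s'. *)
Lemma word_pos_id s : (forall g, pos g -> pos (word_act s g)) -> word_act s =1 id.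
Proof.
have [m] := ubnP (size s); elim: m s => // m IH s.
case: (lastP s) => // s' k; rewrite size_rcons -cats1 => hm hs.
have ns : pos (- word_act s' (alpha k)).
  have := hs _ (pos_simple k); rewrite word_act_cat /=.
  by rewrite refl_fun_self ?root_nz ?simple_root // word_actN.
have [s1 [j [s2 [es e2]]]] := word_exchange (pos_simple k) ns.
(* Since alpha_j = s2(alpha_k), the reflection s_j is s2 s_k s2^-1, and the two factors s_k
   cancel. *)
have es12 : word_act (s' ++ [:: k]) =1 word_act (s1 ++ s2).
  move=> v; rewrite es !word_act_cat /= -e2 refl_fun_word word_actK.
  by rewrite refl_funK.
move=> v; rewrite es12; apply: IH => [|g pg]; last by rewrite -es12; apply: hs.
by move: hm; rewrite es !size_cat /=; lia.
Qed.

(** This makes [w^-1] a two-sided inverse of w. *)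
Lemma weyl_lker w : weyl D w -> lker w == 0%VS.
Proof.
move=> /weyl_word[s hs]; apply/lker0P => x y; rewrite !hs.
exact: can_inj (word_actK s) _ _.
Qed.

Lemma weyl_root w g : weyl D w -> g \in D -> w g \in D.
Proof. by move=> /weyl_word[s hs] gD; rewrite hs word_act_root. Qed.

Lemma weylV_word w s : weyl D w -> w =1 word_act s ->
  (w^-1)%VF =1 word_act (rev s).
Proof.
move=> ww hs v; rewrite -{1}[v](word_act_revK s) -hs.
exact: (lker0_lfunK (weyl_lker ww)).
Qed.

Lemma weylV_root w g : weyl D w -> g \in D -> (w^-1)%VF g \in D.
Proof.
move=> ww gD; have [s hs] := weyl_word ww.
by rewrite (weylV_word ww hs) word_act_root.
Qed.

(** * The grading and the generated sets <K> *)

Section Grading.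
Variable t : 'I_n.
Local Notation deg g := (coef P g t).

Lemma grade_ge1P g : grade_ge1 D P t g <-> g \in D /\ 1 <= deg g.
Proof.
by split=> [[k k1 [gD ->]]|[gD g1]] //; exists (deg g).
Qed.

Lemma grade_ge1_pos g : grade_ge1 D P t g -> pos g.
Proof. by move=> /grade_ge1P[gD g1]; apply: coef_gt0_pos gD _; apply: lt_le_trans g1. Qed.

Lemma root_gen_closed (K M : set 'rV[R]_n) : K `<=` M ->
  (forall x y, M x -> M y -> x + y \in D -> M (x + y)) -> root_gen D K `<=` M.
Proof.
move=> KM MD g [k _]; elim: k g => [|k IH] g /=; first exact: KM.
by move=> [gD [x [y [Kx /IH My e]]]]; rewrite e in gD *; apply: MD => //; apply: KM.
Qed.

Lemma root_gen_ge1 K : K `<=` grade D P t 1 -> root_gen D K `<=` grade_ge1 D P t.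
Proof.
move=> K1; apply: root_gen_closed => [g /K1 g1|x y]; first by exists 1.
move=> /grade_ge1P[xD x1] /grade_ge1P[yD y1] sD; apply/grade_ge1P; split=> //.
by rewrite coefD //; lia.
Qed.

Lemma root_gen_base (K : set 'rV[R]_n) x y : K x -> root_gen D K y -> x + y \in D ->
  root_gen D K (x + y).
Proof. by move=> Kx [k _ yk] sD; exists k.+1 => //; split=> //; exists x, y. Qed.

(** [root_pow] only adds one element of K at a time. For x = a + x' with a in K, [root_add3] makes y
    + a or y + x' a root; then x' is added to a + y, or a to x' + y, by induction on x'. *)
Lemma root_genD (K : set 'rV[R]_n) x y : K `<=` pos ->
  root_gen D K x -> root_gen D K y -> x + y \in D -> root_gen D K (x + y).
Proof.
move=> Kpos; have Gpos : root_gen D K `<=` pos.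
  by apply: root_gen_closed => // a b; apply: posD.
move=> [k _ xk]; elim: k x xk y => [|k IH] x /=; first by move=> *; apply: root_gen_base.
move=> [xD [a [x' [Ka x'k e]]]] y Gy sD; rewrite e in xD sD *.
have Gx' : root_gen D K x' by exists k.
have [pa px' py] : [/\ pos a, pos x' & pos y] by split; [apply: Kpos|apply: Gpos|apply: Gpos].
have eq1 : a + x' + y = x' + (a + y) by rewrite addrCA addrA.
have [|h|h] := @root_add3 y a x' py.1 pa.1 px'.1 (root_nz xD) _
  (posD_neq0 py pa) (posD_neq0 py px').
- by rewrite -addrA addrC.
- by rewrite eq1; apply: IH => //; rewrite -?eq1 //; apply: root_gen_base; rewrite // addrC.
- rewrite -addrA; apply: root_gen_base; rewrite ?addrA //.
  by apply: IH; rewrite // addrC.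
Qed.

(** * Comparison of M with <J> *)

Section Halves.
Variable f : 'End('rV[R]_n).
Hypotheses (fI : injective f) (fD : forall g, g \in D -> f g \in D)
  (fS : forall h, h \in D -> exists2 g, g \in D & f g = h).

(** The set M for [f]; [pos_image1] is J. *)
Definition pos_image : set 'rV[R]_n :=
  [set g | grade_ge1 D P t g /\ pos (f g)].
Definition pos_image1 : set 'rV[R]_n :=
  [set g | grade D P t 1 g /\ pos (f g)].

Lemma pos_image1_sub : pos_image1 `<=` pos_image.
Proof. by move=> g [g1 pg]; split=> //; exists 1. Qed.

Lemma pos_imageD x y :
  pos_image x -> pos_image y -> x + y \in D -> pos_image (x + y).
Proof.
move=> [/grade_ge1P[xD x1] px] [/grade_ge1P[yD y1] py] sD; split.
  by apply/grade_ge1P; rewrite coefD //; split=> //; lia.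
by rewrite linearD; apply: posD => //; rewrite -linearD fD.
Qed.

Local Notation gen := (root_gen D pos_image1).

Lemma gen_sub : gen `<=` pos_image.
Proof. exact: root_gen_closed pos_image1_sub pos_imageD. Qed.

Lemma genD x y : gen x -> gen y -> x + y \in D -> gen (x + y).
Proof.
by apply: root_genD => g /pos_image1_sub[/grade_ge1_pos].
Qed.

(** Since g has degree 1, the degree bounds force deg d = 0, so g - d stays in J. Here and in
    [genB], -d is the element of S of degree at most 0 being added. *)
Lemma gen_base g d : pos_image1 g -> d \in D -> pos (f (- d)) -> 0 <= deg d ->
  g - d \in D -> 1 <= deg (g - d) -> gen (g - d).
Proof.
move=> [[gD g1] pg] dD pd d0 sD s1; exists 0%N => //; split; last first.
  by rewrite linearD; apply: posD => //; rewrite -linearD fD.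
by split=> //; move: s1; rewrite coefD ?rootN // coefN //; lia.
Qed.

(* Splitting g = a + b with a of degree 1, one of a - d and b - d is a root by
   root_add3; it or its negative then allows induction on b. *)
Lemma genB g d : gen g -> d \in D -> pos (f (- d)) -> 0 <= deg d ->
  g - d \in D -> 1 <= deg (g - d) -> gen (g - d).
Proof.
move=> [k _ gk]; elim: k g gk d => [|k IH] g /=; first by move=> Jg d; apply: gen_base.
move=> [gD [a [b [Ja bk e]]]] d dD pd d0 sD s1; rewrite e in gD sD s1 *.
have Gb : gen b by exists k.
have [[aD a1] pa] := Ja; have [/grade_ge1P[bD b1] pb] := gen_sub Gb.
have NdD := rootN dD.
have nz x : pos (f x) -> - d + x != 0.
  by move=> px; apply: contraTneq (posD_neq0 pd px) => e0; rewrite -linearD e0 linear0 eqxx.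
have pB x : pos (f x) -> x - d \in D -> pos (f (x - d)).
  by move=> px xD; rewrite linearD; apply: posD => //; rewrite -linearD fD.
have dB x : x \in D -> deg (x - d) = deg x - deg d by move=> xD; rewrite coefD // coefN.
have ea : a + b - d = a - d + b by rewrite addrAC.
have eb : a + b - d = a + (b - d) by rewrite addrA.
have [|h|h] := @root_add3 (- d) a b NdD aD bD (root_nz gD) _ (nz a pa) (nz b pb).
- by rewrite -addrA addrC.
- rewrite addrC in h; have [h0|h0] := leP 1 (deg (a - d)).
    by rewrite ea; apply: genD; rewrite -?ea //; apply: gen_base.
  (* Now d - a has degree at least 0 and f(a - d) is positive, so d - a can replace d in the
     induction hypothesis for b. *)
  have e' : a + b - d = b - - (a - d) by rewrite opprK [RHS]addrC.
  rewrite e'; apply: IH; rewrite -?e' ?opprK ?rootN //; first exact: pB.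
  by rewrite coefN //; lia.
- rewrite addrC in h; have [h0|h0] := leP 1 (deg (b - d)).
    by rewrite eb; apply: root_gen_base; rewrite -?eb //; apply: IH.
  have e' : a + b - d = a - - (b - d) by rewrite opprK addrA.
  rewrite e'; apply: gen_base; rewrite -?e' ?opprK ?rootN //; first exact: pB.
  by rewrite coefN //; lia.
Qed.

Lemma pos_image_gen :
  (forall g i, g \in D -> f g = alpha i -> deg g <= 1) -> pos_image = gen.
Proof.
move=> hle; apply/seteqP; split; last exact: gen_sub.
suff H h : pos h -> forall g, g \in D -> f g = h -> 1 <= deg g -> gen g.
  by move=> g [/grade_ge1P[gD g1] pg]; apply: H pg _ gD erefl g1.
move: h; apply: height_ind => h ph IH g gD fg g1.
have [[i hi]|[x [y [px py hxy]]]] := pos_decomp ph.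
  exists 0%N => //; split; last by rewrite fg.
  by split=> //; have := hle g i gD (etrans fg hi); lia.
have [g1' g1D f1] := fS px.1; have [g2' g2D f2] := fS py.1.
have eg : g = g1' + g2' by apply: fI; rewrite linearD /= f1 f2 fg.
have hx := height_gt0 px; have hy := height_gt0 py.
(* As deg g >= 1, one of the two summands has degree at least 1; it is the one passed as v. *)
have key u v : u \in D -> v \in D -> g = u + v -> pos (f u) -> pos (f v) ->
    height (f u) < height h -> height (f v) < height h -> 1 <= deg v -> gen g.
  move=> uD vD e pu pv lu lv v1; have Gv := IH _ pv lv v vD erefl v1.
  have [u1|u0] := leP 1 (deg u).
    by rewrite e; apply: genD; rewrite -?e //; apply: IH pu lu _ _ _ _.
  (* With deg u <= 0, adding u amounts to subtracting d = -u in [genB]. *)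
  have e' : g = v - - u by rewrite opprK addrC.
  rewrite e'; apply: genB; rewrite -?e' ?opprK ?rootN //.
  by rewrite coefN //; lia.
have hh : height h = height x + height y by rewrite hxy heightD.
have [v1|v0] := leP 1 (deg g2').
  by apply: (key g1' g2'); rewrite ?f1 ?f2 // hh; lra.
apply: (key g2' g1'); rewrite ?f1 ?f2 //; first by rewrite addrC.
- by rewrite hh; lra.
- by rewrite hh; lra.
- by move: g1; rewrite eg coefD //; lia.
Qed.

(** K is arbitrary in degree 1, since the ideal witnessing [W0min] or [W0max] is not given in terms
    of J. *)
Lemma gen_simple_deg K g i : K `<=` grade D P t 1 -> pos_image = root_gen D K ->
  g \in D -> f g = alpha i -> deg g <= 1.
Proof.
move=> K1 eM gD fg; rewrite leNgt; apply/negP => g2.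
have Mg : pos_image g.
  split; last by rewrite fg; apply: pos_simple.
  by apply/grade_ge1P; split=> //; lia.
move: (Mg); rewrite eM => -[[|k] _ /=]; first by move=> /K1[_ g1]; lia.
move=> [_ [x [y [Kx yk e]]]].
have [_ px] : pos_image x by rewrite eM; exists 0%N.
have [_ py] : pos_image y by rewrite eM; exists k.
by apply: (@simple_indec i _ _ px py); rewrite -fg e linearD.
Qed.

End Halves.

(** * Elements of W^0 and injectivity of eta *)

Lemma grade0_simple i : i != t -> grade D P t 0 (alpha i).
Proof. by move=> it; split; [apply: simple_root|rewrite coef_simple (negPf it)]. Qed.

Lemma W0_pos_grade0 w g : W0 D P t w -> grade D P t 0 g -> pos (w g) -> pos g.
Proof.
move=> [ww hw] [gD g0] pwg; have [//|ng] := pos_or_neg gD.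
case: (posN pwg); rewrite -linearN; apply: hw => //.
by split; [exact: ng.1|rewrite coefN // g0].
Qed.

(* The coordinates k_alpha(w) determine the linear form [w^-1(_) : alpha_t], so
   if they agree for w1 and w2 then w2^-1 w1 preserves degrees; being in W^0,
   both preserve signs in degree 0, so w2^-1 w1 preserves the positive roots. *)
Lemma eta_inj : set_inj (W0 D P t) (eta P t).
Proof.
move=> w1 w2 /set_mem W1 /set_mem W2 /ffunP eE.
have [[ww1 h1] [ww2 h2]] := (W1, W2).
have eC v : coord P t ((w1^-1)%VF v) = coord P t ((w2^-1)%VF v).
  rewrite (coord_sum v) !linear_sum /=; apply: eq_bigr => i _.
  rewrite !linearZ /=; congr (_ * _).
  rewrite -!coef_root ?weylV_root ?simple_root //.
  by have := eE i; rewrite !ffunE /kcoef => ->.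
have [s1 e1] := weyl_word ww1; have [s2 e2] := weyl_word ww2.
have eu v : word_act (rev s2 ++ s1) v = (w2^-1)%VF (w1 v).
  by rewrite word_act_cat -e1 (weylV_word ww2 e2).
have eV v : w2 ((w2^-1)%VF v) = v by apply: lker0_lfunVK; apply: weyl_lker.
suff hid : word_act (rev s2 ++ s1) =1 id.
  by apply/lfunP => v; rewrite -[in LHS](eV (w1 v)) -eu hid.
apply: word_pos_id => g pg; rewrite eu.
set h := (w2^-1)%VF (w1 g).
have hDh : h \in D by rewrite weylV_root // weyl_root // pg.1.
have dh : deg h = deg g.
  by rewrite /coef /h -eC (lker0_lfunK (weyl_lker ww1)).
have := coef_pos t pg; rewrite le_eqVlt => /predU1P[g0|g0]; last first.
  by apply: (@coef_gt0_pos _ t) => //; rewrite dh.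
apply: (W0_pos_grade0 W2); first by split; rewrite // dh -g0.
by rewrite eV; apply: h1 => //; split; [exact: pg.1|rewrite -g0].
Qed.

(** * Inversion sets, and parts (ii) and (iii) *)

Definition inv1 (w : 'End('rV[R]_n)) : set 'rV[R]_n :=
  grade D P t 1 `&` inversions D P w.

(** For m below g in degree 1, the difference g - m involves only simple roots of degree 0, which w
    keeps positive, and -w m = -w g + w(g - m). *)
Lemma inv1_lower_ideal w : W0 D P t w -> lower_ideal D P t (inv1 w).
Proof.
move=> [ww hw]; split=> [g []//|m g m1 [[gD g1] [_ [_ ng]]] [c hc]].
have pm : pos m by apply: (@coef_gt0_pos _ t m1.1); rewrite m1.2.
split=> //; split=> //; split; first by rewrite rootN // weyl_root // m1.1.
have -> : - w m = - w g + w (g - m) by rewrite linearB addKr.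
apply: natcombD ng _; rewrite hc linear_sum.
rewrite (eq_bigr (fun i => (c i)%:R *: w (alpha i))) => [|i _]; last by rewrite linearZ.
apply: natcomb_sum => i ci; have it : i != t.
  apply: contra ci => /eqP->; have : coord P t (g - m) = 0.
    by rewrite linearB /= -!coef_root ?m1.1 // g1 m1.2 subrr.
  by rewrite hc coord_lincomb => /eqP; rewrite pnatr_eq0.
exact: (hw _ (grade0_simple it) (pos_simple i)).2.
Qed.

Lemma weyl_opp_image w : weyl D w ->
  [/\ injective (- w)%VF, forall g, g \in D -> (- w)%VF g \in D &
      forall h, h \in D -> exists2 g, g \in D & (- w)%VF g = h].
Proof.
move=> ww; split=> [x y|g gD|h Dh].
- by rewrite !opp_lfunE => /oppr_inj; apply: (can_inj (lker0_lfunK (weyl_lker ww))).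
- by rewrite opp_lfunE rootN // weyl_root.
- exists (- (w^-1)%VF h); first by rewrite rootN // weylV_root.
  by rewrite opp_lfunE linearN /= opprK (lker0_lfunVK (weyl_lker ww)).
Qed.

Lemma weyl_image w : weyl D w ->
  [/\ injective w, forall g, g \in D -> w g \in D &
      forall h, h \in D -> exists2 g, g \in D & w g = h].
Proof.
move=> ww; split=> [|g|h Dh]; [exact/lker0P/weyl_lker|exact: weyl_root|].
by exists ((w^-1)%VF h); rewrite ?weylV_root // (lker0_lfunVK (weyl_lker ww)).
Qed.

(** It places the elements of [W0min] and [W0max] in W^0, since their prescribed inversion sets lie
    in degrees at least 1. *)
Lemma W0P w : weyl D w -> W0 D P t w <-> inversions D P w `<=` grade_ge1 D P t.
Proof.
move=> ww; split=> [[_ hw] g [pg ng]|hi].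
  have := coef_pos t pg; rewrite le_eqVlt => /predU1P[g0|g0].
    by case: (posN (hw g (conj pg.1 (esym g0)) pg)).
  by apply/grade_ge1P; split; [exact: pg.1|].
split=> // g [gD g0] pg; have [//|ng] := pos_or_neg (weyl_root ww gD).
have /grade_ge1P[_] : grade_ge1 D P t g by apply: hi.
by rewrite g0.
Qed.

Lemma inversions_pos_image w : W0 D P t w ->
  inversions D P w = pos_image (- w)%VF.
Proof.
move=> Ww; apply/seteqP; split=> g; rewrite /pos_image /= opp_lfunE.
  by move=> hg; split; [apply/(W0P Ww.1).1: hg|exact: hg.2].
by move=> [/grade_ge1_pos pg ng].
Qed.

Lemma inversions_pos_imageC w : W0 D P t w ->
  inversions D P w = grade_ge1 D P t `\` pos_image w.
Proof.
move=> Ww; apply/seteqP; split=> g.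
  move=> hg; split; first by apply/(W0P Ww.1).1: hg.
  by move=> [_] /posN; apply; exact: hg.2.
move=> [g1 ng]; have pg := grade_ge1_pos g1; split=> //.
by have [pwg|//] := pos_or_neg (weyl_root Ww.1 pg.1); case: ng.
Qed.

(** Take f = -w: then M = N(w), and the preimage of alpha_i has degree -k_alpha(w), so the bound by
    1 reads k_alpha(w) >= -1. *)
Lemma W0minP w : W0min D P t w <-> W0 D P t w /\ forall i, -1 <= kcoef P t w i.
Proof.
split=> [[I [I1 _] [ww hI]]|[Ww hk]].
  have Ww : W0 D P t w by apply/(W0P ww); rewrite hI; apply: root_gen_ge1.
  split=> // i; have [_ _ fS] := weyl_opp_image ww.
  rewrite inversions_pos_image // in hI.
  set v := (w^-1)%VF (alpha i); have vD : v \in D by rewrite weylV_root ?simple_root.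
  have := @gen_simple_deg _ I (- v) i I1 hI (rootN vD).
  rewrite opp_lfunE linearN /= opprK (lker0_lfunVK (weyl_lker ww)) => /(_ erefl).
  by rewrite coefN // lerNl.
have [fI fD fS] := weyl_opp_image Ww.1.
exists (inv1 w); first exact: inv1_lower_ideal.
split; first exact: Ww.1.
have -> : inv1 w = pos_image1 (- w)%VF.
  rewrite /inv1 inversions_pos_image //; apply/seteqP; split=> g.
    by move=> [g1 [_ ng]].
  by move=> hg; split; [exact: hg.1|exact: pos_image1_sub].
rewrite inversions_pos_image //; apply: pos_image_gen => // g i gD.
rewrite opp_lfunE => wg; have := hk i.
rewrite /kcoef -wg linearN /= (lker0_lfunK (weyl_lker Ww.1)) coefN //; lia.
Qed.

(** Take f = w: then N(w) is the complement of M in Delta(>=1), and the preimage of alpha_i has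
    degree k_alpha(w). *)
Lemma W0maxP w : W0max D P t w <-> W0 D P t w /\ forall i, kcoef P t w i <= 1.
Proof.
split=> [[I _ [ww hI]]|[Ww hk]].
  have Ww : W0 D P t w by apply/(W0P ww); rewrite hI => g [].
  split=> // i; set J := grade D P t 1 `\` I in hI.
  have J1 : J `<=` grade D P t 1 by move=> g [].
  have eJ : pos_image w = root_gen D J.
    have M1 : pos_image w `<=` grade_ge1 D P t by move=> g [].
    (* Complementing twice in Delta(>=1) turns the formula for N(w) into M = <I^c>. *)
    rewrite -(setIidr M1) -setDD -inversions_pos_imageC // hI setDD setIidr //.
    exact: root_gen_ge1.
  apply: (gen_simple_deg J1 eJ); first by rewrite weylV_root ?simple_root.
  exact: (lker0_lfunVK (weyl_lker ww)).
have [fI fD fS] := weyl_image Ww.1.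
exists (inv1 w); first exact: inv1_lower_ideal.
split; first exact: Ww.1.
(* A root of degree 1 outside N(w) is one that w keeps positive, so I^c is J. *)
have -> : grade D P t 1 `\` inv1 w = pos_image1 w.
  rewrite /inv1 inversions_pos_imageC //; apply/seteqP; split=> g.
    move=> [g1 ng]; split=> //; apply: contrapT => npg; apply: ng.
    by split=> //; split=> [|[]//]; exists 1.
  by move=> [g1 pg]; split=> // -[_ [_ []]]; split=> //; exists 1.
rewrite inversions_pos_imageC // (@pos_image_gen w) // => g i gD wg.
by have := hk i; rewrite /kcoef -wg (lker0_lfunK (weyl_lker Ww.1)).
Qed.

End Grading.

End Roots.

Theorem theorem3p14 (R : realType) (n : nat) (D : {fset 'rV[R]_n})
    (P : n.-tuple 'rV[R]_n) (t : 'I_n)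
    (hD : root_system D) (hred : reduced D) (hirr : irreducible D)
    (hP : simple_system D P) :
  [/\ set_inj (W0 D P t) (eta P t),
      eta P t @` W0min D P t =
        eta P t @` [set w | W0 D P t w /\ forall i : 'I_n, -1 <= kcoef P t w i]
    & eta P t @` W0max D P t =
        eta P t @` [set w | W0 D P t w /\ forall i : 'I_n, kcoef P t w i <= 1]].
Proof.
split; first exact: eta_inj.
- by congr (_ @` _); apply/seteqP; split=> w /(W0minP hD hred hP).
- by congr (_ @` _); apply/seteqP; split=> w /(W0maxP hD hred hP).
Qed.
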